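(* Let $(R,\mathfrak m)$ be a local principal ideal domain which is not complete in the $\mathfrak m$-adic topology, and let $\mathcal M$ be a torsion-free $R$-module which is cohomologically finite. Then $\mathcal M$ is finitely generated.
   Context: An $R$-module $\mathcal M$ is called cohomologically finite if $\operatorname{Ext}^i_R(\mathcal M,R)$ is finitely generated as an $R$-module for all $i\ge 0$. *)

(* Defs.v *)
From HB Require Import structures.
From mathcomp Require Import all_boot all_algebra.
From mathcomp Require Import generic_quotient ring_quotient.
From mathcomp Require Import boolp classical_sets functions.
From mathcomp Require Import freeg.

Set Implicit Arguments.
Unset Strict Implicit.
Unset Printing Implicit Defensive.

Import GRing.Theory.

Local Open Scope classical_set_scope.
Local Open Scope ring_scope.
Local Open Scope quotient_scope.

Section Ideals.
Variable R : comNzRingType.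
Implicit Types (I J m : set R) (u : nat -> R) (l : R) (n : nat).

Definition is_ideal I :=
  [/\ I 0, (forall x y, I x -> I y -> I (x + y)) & (forall a x, I x -> I (a * x))].

Definition principal I := exists a, I = range (fun b => b * a).

Definition maximal_ideal m :=
  [/\ is_ideal m, m <> setT &
      forall J, is_ideal J -> m `<=` J -> J = m \/ J = setT].

Definition is_local_with m :=
  maximal_ideal m /\ forall J, maximal_ideal J -> J = m.

Definition ideal_mul I J : set R :=
  smallest is_ideal [set x * y | x in I & y in J].

Definition ideal_exp I n : set R := iter n (ideal_mul I) setT.

Definition adic_cauchy I u :=
  forall n, exists N : nat, forall i j,
    (N <= i)%N -> (N <= j)%N -> ideal_exp I n (u i - u j).

Definition adic_cvg I u l :=
  forall n, exists N : nat, forall i, (N <= i)%N -> ideal_exp I n (u i - l).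

(* The topology is first countable, so sequences suffice; uniqueness of the
   limits makes completeness include separatedness. *)
Definition adic_complete I :=
  forall u, adic_cauchy I u -> exists! l, adic_cvg I u l.

End Ideals.

Definition is_pid (R : idomainType) := forall I : set R, is_ideal I -> principal I.

Definition finitely_generated (R : pzRingType) (M : lmodType R) :=
  exists (n : nat) (g : 'I_n -> M),
    forall x : M, exists c : 'I_n -> R, x = \sum_(i < n) c i *: g i.

Definition torsion_free (R : idomainType) (M : lmodType R) :=
  forall (a : R) (x : M), a *: x = 0 -> a = 0 \/ x = 0.

Section Kernel.
Variables (R : pzRingType) (U V : lmodType R) (f : {linear U -> V}).

Definition ker_pred : {pred U} := fun x => f x == 0.

Lemma ker_pred_closed : submod_closed ker_pred.
Proof.
split=> [|a x y]; rewrite !unfold_in /ker_pred ?linear0 //.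
by move=> /eqP fx /eqP fy; rewrite linearP fx fy scaler0 addr0.
Qed.

HB.instance Definition _ := GRing.isSubmodClosed.Build R U ker_pred ker_pred_closed.

Definition ker := {x : U | x \in ker_pred}.

HB.instance Definition _ := SubChoice.on ker.
HB.instance Definition _ := [SubChoice_isSubLmodule of ker by <:].

End Kernel.

Section QuotientModule.
Variables (R : pzRingType) (V : lmodType R) (S : submodClosed V).

(* The library does not derive closure under opposites from submodClosed. *)
Definition submod_zmod_pred : {pred V} := fun x => x \in S.

Lemma submod_zmod_closed : zmod_closed submod_zmod_pred.
Proof. exact: GRing.submod_closedB (submodClosedP S). Qed.

HB.instance Definition _ :=
  GRing.isZmodClosed.Build V submod_zmod_pred submod_zmod_closed.

Definition modquot := Quotient.quot submod_zmod_pred.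

HB.instance Definition _ := GRing.Zmodule.on modquot.
HB.instance Definition _ := ZmodQuotient.on modquot.

Lemma modquot_eqE (x y : V) : (\pi_modquot x == \pi_modquot y) = (x - y \in S).
Proof. by rewrite -Quotient.idealrBE. Qed.

Definition modquot_scale (a : R) (q : modquot) : modquot :=
  \pi_modquot (a *: repr q).

Lemma modquot_scale_pi a x :
  modquot_scale a (\pi_modquot x) = \pi_modquot (a *: x).
Proof.
apply/eqP; rewrite modquot_eqE -scalerBr; apply: rpredZ.
by rewrite -modquot_eqE reprK.
Qed.

Lemma modquot_scaleA a b q :
  modquot_scale a (modquot_scale b q) = modquot_scale (a * b) q.
Proof.
by elim/quotW: q => x; rewrite (modquot_scale_pi b) !modquot_scale_pi scalerA.
Qed.

Lemma modquot_scale1 : left_id 1 modquot_scale.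
Proof. by elim/quotW=> x; rewrite modquot_scale_pi scale1r. Qed.

Lemma modquot_scaleDr : right_distributive modquot_scale +%R.
Proof.
move=> a; elim/quotW=> x; elim/quotW=> y.
by rewrite -pi_addr !modquot_scale_pi scalerDr pi_addr.
Qed.

Lemma modquot_scaleDl q : {morph modquot_scale^~ q : a b / a + b}.
Proof.
by move=> a b; elim/quotW: q => x; rewrite !modquot_scale_pi scalerDl pi_addr.
Qed.

HB.instance Definition _ := GRing.Zmodule_isLmodule.Build R modquot
  modquot_scaleA modquot_scale1 modquot_scaleDr modquot_scaleDl.

End QuotientModule.

Section Homology.
Variables (R : pzRingType) (U V W : lmodType R).
Variables (f : {linear U -> V}) (g : {linear V -> W}).

Definition boundary_pred : {pred ker g} := fun z => `[< exists u, f u = val z >].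

Lemma boundary_pred_closed : submod_closed boundary_pred.
Proof.
split=> [|a x y]; rewrite !unfold_in /boundary_pred.
  by apply/asboolP; exists 0; rewrite !linear0.
move=> /asboolP[u fu] /asboolP[v fv]; apply/asboolP; exists (a *: u + v).
by rewrite !linearP fu fv.
Qed.

HB.instance Definition _ :=
  GRing.isSubmodClosed.Build R (ker g) boundary_pred boundary_pred_closed.

(* ker g / im f; in every use below g \o f = 0. *)
Definition homology : lmodType R := modquot boundary_pred.

End Homology.

Section Hom.
Variables (R : comNzRingType) (U V : lmodType R).

Definition hom_pred : {pred U -> V} := fun f => `[< linear f >].

Lemma hom_pred_closed : submod_closed hom_pred.
Proof.
split=> [|a f g]; rewrite !unfold_in /hom_pred.
  by apply/asboolP=> b x y; change (0 = b *: 0 + 0 :> V); rewrite scaler0 addr0.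
move=> /asboolP lf /asboolP lg; apply/asboolP=> b x y.
change (a *: f (b *: x + y) + g (b *: x + y) =
        b *: (a *: f x + g x) + (a *: f y + g y)).
by rewrite lf lg !scalerDr !scalerA addrACA (mulrC a b).
Qed.

HB.instance Definition _ :=
  GRing.isSubmodClosed.Build R (U -> V) hom_pred hom_pred_closed.

Definition hom := {f : U -> V | f \in hom_pred}.

HB.instance Definition _ := SubChoice.on hom.
HB.instance Definition _ := [SubChoice_isSubLmodule of hom by <:].

End Hom.

Section Precomposition.
Variables (R : comNzRingType) (U U' V : lmodType R) (d : {linear U -> U'}).

Lemma precomp_subproof (phi : hom U' V) : val phi \o d \in @hom_pred R U V.
Proof.
case: phi => f /= /asboolP lf; apply/asboolP=> a x y /=.
by rewrite linearP lf.
Qed.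

Definition precomp (phi : hom U' V) : hom U V :=
  exist _ (val phi \o d) (precomp_subproof phi).

Lemma precomp_is_linear : linear precomp.
Proof. by move=> a f g; apply/val_inj/funext. Qed.

HB.instance Definition _ :=
  GRing.isLinear.Build R (hom U' V) (hom U V) _ precomp precomp_is_linear.

End Precomposition.

Arguments precomp {R U U'} V d.

Definition projective (R : pzRingType) (P : lmodType R) :=
  forall (A B : lmodType R) (g : {linear A -> B}) (f : {linear P -> B}),
    (forall b, exists a, g a = b) ->
    exists h : {linear P -> A}, forall x, g (h x) = f x.

Record proj_resolution (R : pzRingType) (M : lmodType R) := ProjResolution {
  res_mod : nat -> lmodType R;
  res_diff : forall n, {linear res_mod n.+1 -> res_mod n};
  res_aug : {linear res_mod 0%N -> M};
  res_projective : forall n, projective (res_mod n);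
  res_aug_surj : forall x, exists y, res_aug y = x;
  res_exact0 : forall x, res_aug x = 0 <-> exists y, res_diff 0 y = x;
  res_exactS : forall n x,
    res_diff n x = 0 <-> exists y, res_diff n.+1 y = x
}.

(* The free cover R^(M) -> M and the resolution obtained by iterating it on
   the successive kernels. *)
Section FreeResolution.
Variable R : nzRingType.

Section FreeModule.
Variables (K : choiceType) (V : lmodType R) (h : K -> V).

Lemma fglift_is_linear : linear (fglift h : {freeg K / R} -> V).
Proof.
have fgliftB D E : fglift h (D - E : {freeg K / R}) = fglift h D - fglift h E.
  exact: lift_is_additive.
have fglift0 : fglift h (0 : {freeg K / R}) = 0.
  by rewrite -(subrr (0 : {freeg K / R})) fgliftB subrr.
have fgliftD D E : fglift h (D + E : {freeg K / R}) = fglift h D + fglift h E.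
  by rewrite -[E in LHS]opprK -[- E]add0r !fgliftB fglift0 sub0r opprK.
have fglift_sum (F : K -> {freeg K / R}) s :
    fglift h (\sum_(k <- s) F k) = \sum_(k <- s) fglift h (F k).
  exact: (big_morph _ fgliftD fglift0).
move=> a D E; rewrite fgliftD; congr (_ + _).
rewrite -[D in RHS]freeg_sumE [a *: D]/(fgscale a D) /fgscale !fglift_sum.
by rewrite scaler_sumr; apply: eq_bigr => k _; rewrite !liftU scalerA.
Qed.

HB.instance Definition _ := GRing.isLinear.Build R {freeg K / R} V _
  (fglift h : {freeg K / R} -> V) fglift_is_linear.

End FreeModule.

Lemma freeg_projective (K : choiceType) : projective ({freeg K / R} : lmodType R).
Proof.
move=> A B g f gsurj.
have [a ga] := boolp.choice (fun k : K => gsurj (f << k >>)).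
exists (fglift a : {linear {freeg K / R} -> A}) => D /=.
rewrite -[D]freeg_sumE !linear_sum; apply: eq_bigr => k _ /=.
rewrite liftU linearZ /= ga -linearZ /=; congr (f _).
by apply/eqP/freeg_eqP=> x; rewrite coeffZ !coeffU mul1r.
Qed.

Definition free_cover (M : lmodType R) : {linear {freeg M / R} -> M} :=
  fglift (id : M -> M).

Arguments free_cover M : clear implicits.

Variable M : lmodType R.

Fixpoint syzygy n : lmodType R :=
  if n is k.+1 then ker (free_cover (syzygy k)) else M.

Definition free_mod n : lmodType R := {freeg (syzygy n) / R}.

Definition free_diff n : {linear free_mod n.+1 -> free_mod n} :=
  (val : ker (free_cover (syzygy n)) -> free_mod n) \o free_cover (syzygy n.+1).

Lemma free_cover_surj (V : lmodType R) (x : V) : exists y, free_cover V y = x.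
Proof. by exists << x >>; rewrite /= liftU scale1r. Qed.

Lemma free_cover_exact n (x : free_mod n) :
  free_cover (syzygy n) x = 0 <-> exists y, free_diff n y = x.
Proof.
split=> [fx0|[y <-]]; last exact/eqP/(valP (free_cover (syzygy n.+1) y)).
have xk : x \in ker_pred (free_cover (syzygy n)) by apply/eqP.
have [y yx] := free_cover_surj (exist _ x xk : syzygy n.+1).
by exists y; rewrite /= yx.
Qed.

Lemma free_diff_exact n (x : free_mod n.+1) :
  free_diff n x = 0 <-> exists y, free_diff n.+1 y = x.
Proof.
rewrite -free_cover_exact; split=> [x0|x0]; first exact/val_inj.
by rewrite /= x0.
Qed.

Definition free_resolution : proj_resolution M :=
  ProjResolution (fun n => @freeg_projective (syzygy n))
    (@free_cover_surj M) (@free_cover_exact 0) free_diff_exact.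

End FreeResolution.

Section Ext.
Variables (R : comNzRingType) (M N : lmodType R).

(* Cohomology of 0 -> Hom(P_0, N) -> Hom(P_1, N) -> ... *)
Definition resolution_ext (P : proj_resolution M) (i : nat) : lmodType R :=
  if i is k.+1
  then homology (precomp N (res_diff P k)) (precomp N (res_diff P k.+1))
  else homology (\0 : {linear hom (res_mod P 0) N -> hom (res_mod P 0) N})
                (precomp N (res_diff P 0)).

Definition Ext (i : nat) : lmodType R :=
  resolution_ext (free_resolution M) i.

End Ext.

Definition cohomologically_finite (R : comNzRingType) (M : lmodType R) :=
  forall i, finitely_generated (Ext M R^o i).

(* Main.v *)
(* Let K be the fraction field of R and p a uniformizer, nonzero because R is
   not complete. Over a PID divisible modules are injective, so
   0 -> R -> K -> K/R -> 0 is an injective resolution; as p is injective on M,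
   Ext^1(M, R) is divisible by p, hence 0 by Nakayama, and every map M -> K/R
   lifts to M -> K. Let x in M be killed by all of Hom(M, R). Lifting a map
   M -> K/R that kills p M and sends x to 1/p would give a map M -> R not
   killing x, so x is in p M; iterating gives s_0 = x, s_k = p s_(k+1).
   If x <> 0, a Cauchy sequence v_k without limit defines a map
   s_k |-> v_k / p^k mod R, which extends to M -> K/R, and the value at x of a
   lift to K would be a limit of v. So x = 0, M embeds into R^n by finitely
   many generators of Hom(M, R), and R is noetherian. *)

From HB Require Import structures.
From mathcomp Require Import all_boot all_algebra.
From mathcomp Require Import generic_quotient ring_quotient.
From mathcomp Require Import classical_sets boolp.
From mathcomp Require Import ring.
Require Import Defs.

Set Implicit Arguments.
Unset Strict Implicit.
Unset Printing Implicit Defensive.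

Import GRing.Theory.
Local Open Scope classical_set_scope.
Local Open Scope ring_scope.
Local Open Scope quotient_scope.

(** * Zorn's lemma above a given set; injectivity of divisible modules over a PID *)

Lemma Zorn_above (T : Type) (P : set (set T)) (A : set T) :
    P A ->
    (forall F, F !=set0 -> F `<=` P -> total_on F subset ->
       P (\bigcup_(X in F) X)) ->
  exists B, [/\ A `<=` B, P B & forall C, B `<=` C -> P C -> C = B].
Proof.
move=> PA Pchain.
(* Zorn is applied to the sets whose union with [A] satisfies [P], so that the empty chain is
   covered by [PA]. *)
have [|B [PB Bmax]] := @Zorn_bigcup T (fun B => P (A `|` B)).
  move=> F FP Ftot; have [->|F0] := eqVneq F set0.
    by rewrite bigcup_set0 setU0.
  rewrite (_ : A `|` _ = \bigcup_(Y in [set A `|` X | X in F]) Y).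
    apply: Pchain => [|_ [X FX <-]|_ _ [X FX <-] [Y FY <-]].
    - by move/set0P: F0 => [X FX]; exists (A `|` X), X.
    - exact: FP.
    - by have [XY|YX] := Ftot X Y FX FY; [left|right]; apply: setUS.
  rewrite bigcup_image eqEsubset; split=> [x [Ax|[X FX Xx]]|x [X FX []]].
  - by move/set0P: F0 => [X FX]; exists X => //; left.
  - by exists X => //; right.
  - by left.
  - by right; exists X.
exists (A `|` B); split=> // C BC PC.
have AC : A `|` C = C by apply/setUidPr/(subset_trans _ BC)/subsetUl.
have BC' : B `<=` C by apply: subset_trans BC; apply: subsetUr.
apply: contrapT => CB; apply: (Bmax C); last by rewrite AC.
by split=> // CB'; apply: CB; rewrite -AC; congr (_ `|` _); rewrite eqEsubset.
Qed.

Definition divisible (R : pzRingType) (D : lmodType R) :=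
  forall (a : R) (d : D), a != 0 -> exists d', a *: d' = d.

(** Baer's argument, for a partial map given by its graph [G], a submodule of V x D. Graphs let a
    map on a domain such as R x + p M be given without forming that submodule. *)
Lemma divisible_extend_relation (R : idomainType) (V D : lmodType R)
    (G : set (V * D)) :
    is_pid R -> divisible D -> G 0 ->
    (forall a p q, G p -> G q -> G (a *: p + q)) ->
    (forall d, G (0, d) -> d = 0) ->
  exists h : {linear V -> D}, forall v d, G (v, d) -> h v = d.
Proof.
move=> pidR divD G0 Glin Gfun.
pose good (H : set (V * D)) := [/\ H 0,
  (forall a p q, H p -> H q -> H (a *: p + q)) & forall d, H (0, d) -> d = 0].
have [|F [H0 FH0] Fgood Ftot|H [GH [H0 Hlin Hfun] Hmax]] :=
    @Zorn_above _ good G.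
- by [].
- split=> [|a p q [X FX Xp] [Y FY Yq]|d [X FX]].
  + by exists H0 => //; case: (Fgood _ FH0).
  + have [XY|YX] := Ftot X Y FX FY.
      by exists Y => //; case: (Fgood _ FY) => _ + _; apply=> //; apply: XY.
    by exists X => //; case: (Fgood _ FX) => _ + _; apply=> //; apply: YX.
  + by case: (Fgood _ FX) => _ _; apply.
have HD p q : H p -> H q -> H (p + q).
  by move=> Hp Hq; rewrite -[p]scale1r; apply: Hlin.
have HZ a p : H p -> H (a *: p).
  by move=> Hp; rewrite -[_ *: _]addr0; apply: Hlin.
have HN p : H p -> H (- p) by rewrite -scaleN1r; apply: HZ.
have Hdom v : exists d, H (v, d).
  pose I : set R := fun a => exists d, H (a *: v, d).
  have [|c Ic] := pidR I.
    split=> [|a b [d Hd] [e He]|a b [d Hd]].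
    - by exists 0; rewrite scale0r.
    - by exists (d + e); rewrite scalerDl; apply: (HD _ _ Hd He).
    - by exists (a *: d); rewrite -scalerA; apply: (HZ a _ Hd).
  have [d0 Hd0] : exists d, H (c *: v, d).
    by rewrite -[exists d, _]/(I c) Ic; exists 1; rewrite // mul1r.
  (* A value at [v] must solve c d1 = d0, where [c] generates the ideal of all a with a v in the
     domain. If c = 0, then d0 = 0 because [H] is single-valued. *)
  have [d1 cd1] : exists d1, c *: d1 = d0.
    have [c0|] := eqVneq c 0; last exact: divD.
    exists 0; rewrite scaler0; apply/esym/Hfun.
    by move: Hd0; rewrite c0 scale0r.
  pose H' : set (V * D) := fun p => exists r, H (p - r *: (v, d1)).
  have HH' : H `<=` H' by move=> p Hp; exists 0; rewrite scale0r subr0.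
  exists d1; rewrite -(Hmax H') //.
    by exists 1; rewrite scale1r subrr.
  split=> [|a p q [r Hr] [s Hs]|d [r Hr]].
  - exact: HH'.
  - exists (a * r + s); rewrite scalerDl opprD addrACA -scalerA -scalerBr.
    exact: Hlin.
  (* Here r v lies in the domain of [H], so r = s c; adding s (c v, d0) to the element in [Hr]
     leaves (0, d) in [H]. *)
  - have /HN := Hr; rewrite opprB => Hr'.
    have : exists e, H (r *: v, e).
      by exists (r *: d1 - d); move: Hr'; congr H; congr pair; rewrite /= subr0.
    rewrite -[exists e, _]/(I r) Ic => -[s _ sc].
    apply: Hfun; have := HD _ _ Hr (HZ s _ Hd0).
    congr H; congr pair => /=; first by rewrite sub0r scalerA sc addNr.
    by rewrite -cd1 scalerA sc subrK.
have [h Hh] := boolp.choice Hdom.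
have h_uniq v d : H (v, d) -> h v = d.
  move=> Hd; apply/eqP; rewrite -subr_eq0; apply/eqP/Hfun.
  by have := HD _ _ (Hh v) (HN _ Hd); congr H; congr pair; rewrite /= subrr.
have hlin : linear h by move=> a x y; apply/h_uniq/(Hlin _ _ _ (Hh x) (Hh y)).
pose hL := GRing.isLinear.Build R V D _ h hlin.
exists (HB.pack_for {linear V -> D} h hL) => v d /GH; exact: h_uniq.
Qed.

(** The kernel of [i] may be nonzero, so that [i] can be a differential or a multiple of an
    augmentation. *)
Lemma divisible_extend (R : idomainType) (W V D : lmodType R)
    (i : {linear W -> V}) (f : {linear W -> D}) :
    is_pid R -> divisible D -> (forall w, i w = 0 -> f w = 0) ->
  exists h : {linear V -> D}, forall w, h (i w) = f w.
Proof.
move=> pidR divD kif.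
have [|a p q [w _ <-] [w' _ <-]|d [w _ [iw <-]]|h hE] :=
    @divisible_extend_relation R V D (range (fun w => (i w, f w))) pidR divD.
- by exists 0; rewrite ?linear0.
- by exists (a *: w + w'); rewrite ?linearP.
- exact: kif.
- by exists h => w; apply: hE; exists w.
Qed.

Lemma linear_factor (R : pzRingType) (W V D : lmodType R)
    (g : {linear W -> V}) (f : {linear W -> D}) :
    (forall v, exists w, g w = v) -> (forall w, g w = 0 -> f w = 0) ->
  exists h : {linear V -> D}, forall w, h (g w) = f w.
Proof.
move=> gsurj kgf; have [s gs] := boolp.choice gsurj.
have hg w : f (s (g w)) = f w.
  by apply/eqP; rewrite -subr_eq0 -linearB kgf // linearB gs subrr.
have hlin : linear (f \o s).
  by move=> a x y /=; rewrite -linearP -[in RHS]hg linearP /= !gs.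
pose hL := GRing.isLinear.Build R V D _ (f \o s) hlin.
by exists (HB.pack_for {linear V -> D} (f \o s) hL).
Qed.

(** * The fraction field K and the quotient K/R as R-modules *)

Section QuotientMap.
Variables (R : pzRingType) (V : lmodType R) (S : submodClosed V).

Definition modquot_pi (x : V) : modquot S := \pi_(modquot S) x.

Lemma modquot_pi_is_linear : linear modquot_pi.
Proof.
move=> a x y; rewrite /modquot_pi pi_addr; congr (_ + _).
exact/esym/modquot_scale_pi.
Qed.

HB.instance Definition _ := GRing.isLinear.Build R V (modquot S) _
  modquot_pi modquot_pi_is_linear.

Lemma modquot_pi_surj (q : modquot S) : exists x, modquot_pi x = q.
Proof. by elim/quotW: q => x; exists x. Qed.

Lemma modquot_pi_eq0 x : modquot_pi x = 0 <-> x \in S.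
Proof. by rewrite -[x in x \in S]subr0 -modquot_eqE pi_zeror; split=> /eqP. Qed.

End QuotientMap.

Definition fracmod (R : idomainType) := {fraction R}.
HB.instance Definition _ (R : idomainType) := GRing.Field.on (fracmod R).

Section FractionModule.
Variable R : idomainType.

Definition frac_scale (a : R) (x : fracmod R) : fracmod R := tofrac a * x.

Lemma frac_scaleA a b x : frac_scale a (frac_scale b x) = frac_scale (a * b) x.
Proof. by rewrite /frac_scale rmorphM mulrA. Qed.

Lemma frac_scale1 : left_id 1 frac_scale.
Proof. by move=> x; rewrite /frac_scale rmorph1 mul1r. Qed.

Lemma frac_scaleDr : right_distributive frac_scale +%R.
Proof. by move=> a x y; rewrite /frac_scale mulrDr. Qed.

Lemma frac_scaleDl x : {morph frac_scale^~ x : a b / a + b}.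
Proof. by move=> a b; rewrite /frac_scale rmorphD mulrDl. Qed.

HB.instance Definition _ := GRing.Zmodule_isLmodule.Build R (fracmod R)
  frac_scaleA frac_scale1 frac_scaleDr frac_scaleDl.

Lemma fracmod_scaleE a (x : fracmod R) : a *: x = tofrac a * x.
Proof. by []. Qed.

Definition to_fracmod (a : R^o) : fracmod R := tofrac (a : R).

Lemma to_fracmod_is_linear : linear to_fracmod.
Proof.
move=> a x y; rewrite /to_fracmod -[a *: x]/((a : R) * x).
by rewrite rmorphD rmorphM.
Qed.

HB.instance Definition _ := GRing.isLinear.Build R R^o (fracmod R) _
  to_fracmod to_fracmod_is_linear.

Lemma to_fracmod_inj : injective to_fracmod.
Proof. by move=> a b /eqP; rewrite tofrac_eq => /eqP. Qed.

Definition integral_pred : {pred fracmod R} :=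
  fun x => `[< exists a, x = to_fracmod a >].

Lemma integral_closed : submod_closed integral_pred.
Proof.
split=> [|a x y]; rewrite !unfold_in /integral_pred.
  by apply/asboolP; exists 0; rewrite linear0.
move=> /asboolP[b ->] /asboolP[c ->]; apply/asboolP; exists (a *: b + c).
by rewrite linearP.
Qed.

HB.instance Definition _ :=
  GRing.isSubmodClosed.Build R (fracmod R) integral_pred integral_closed.

Definition fracquot : lmodType R := modquot integral_pred.

Definition to_fracquot : {linear fracmod R -> fracquot} :=
  modquot_pi integral_pred.

Lemma to_fracquot_surj (q : fracquot) : exists x, to_fracquot x = q.
Proof. exact: modquot_pi_surj. Qed.

Lemma to_fracquot_eq0 x : to_fracquot x = 0 <-> exists a, x = to_fracmod a.
Proof.
by split=> [/modquot_pi_eq0/asboolP|?] //; apply/modquot_pi_eq0/asboolP.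
Qed.

Lemma fracmod_divisible : divisible (fracmod R).
Proof.
move=> a x a0; exists ((tofrac a)^-1 * x).
by rewrite fracmod_scaleE mulrA mulfV ?mul1r // tofrac_eq0.
Qed.

Lemma fracquot_divisible : divisible fracquot.
Proof.
move=> a q a0; have [x <-] := to_fracquot_surj q.
have [y <-] := fracmod_divisible x a0.
by exists (to_fracquot y); rewrite linearZ.
Qed.

End FractionModule.

Arguments to_fracquot {R}.

(** * Ideals and the adic topology of a local PID *)

Definition multiple (R : comNzRingType) (a : R) : set R :=
  range (fun b => b * a).

Section Ideals.
Variable R : comNzRingType.
Implicit Types (a x y : R) (I J : set R).

Lemma multiple_ideal a : is_ideal (multiple a).
Proof.
split=> [|_ _ [b _ <-] [c _ <-]|b _ [c _ <-]].
- by exists 0; rewrite ?mul0r.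
- by exists (b + c); rewrite ?mulrDl.
- by exists (b * c); rewrite ?mulrA.
Qed.

Lemma multipleB a x y : multiple a x -> multiple a y -> multiple a (x - y).
Proof.
have [_ aD aM] := multiple_ideal a => ax ay.
by apply: aD => //; rewrite -mulN1r; apply: aM.
Qed.

Lemma proper_ideal_maximal I : is_ideal I -> ~ I 1 ->
  exists2 J, maximal_ideal J & I `<=` J.
Proof.
move=> idI I1; have [] := @Zorn_above R (fun J => is_ideal J /\ ~ J 1) I.
- by [].
- move=> F [J0 FJ0] Fproper Ftot; split; last first.
    by move=> [J FJ J1]; case: (Fproper _ FJ).
  split=> [|x y [X FX Xx] [Y FY Yy]|a x [X FX Xx]].
  + by exists J0 => //; have [[]] := Fproper _ FJ0.
  + have [XY|YX] := Ftot X Y FX FY.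
      exists Y => //; have [[_ YD _] _] := Fproper _ FY.
      by apply: YD => //; apply: XY.
    exists X => //; have [[_ XD _] _] := Fproper _ FX.
    by apply: XD => //; apply: YX.
  + by exists X => //; have [[_ _ +] _] := Fproper _ FX; apply.
- move=> J [IJ [idJ J1] Jmax]; exists J => //; split=> // [JT|K idK JK].
    by apply: J1; rewrite JT.
  have [K1|K1] := pselect (K 1); last by left; apply: Jmax.
  right; apply/seteqP; split=> // x _; rewrite -[x]mulr1.
  by case: idK => _ _; apply.
Qed.

Lemma ideal_exp_multiple a n : ideal_exp (multiple a) n = multiple (a ^+ n).
Proof.
elim: n => [|n IHn].
  by apply/seteqP; split=> // x _; exists x; rewrite // expr0 mulr1.
rewrite [LHS]/(ideal_mul _ (ideal_exp _ n)) IHn; apply/seteqP; split=> x.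
  apply; split; first exact: multiple_ideal.
  move=> _ [_ [b _ <-] [_ [c _ <-] <-]]; exists (b * c) => //.
  by rewrite exprS mulrACA.
move=> [b _ <-] K [_]; apply; exists a; first by exists 1; rewrite ?mul1r.
by exists (b * a ^+ n); [exists b|rewrite exprS mulrCA].
Qed.

End Ideals.

(** Such a [p] generates the unique maximal ideal; it is 0 when [R] is a field. *)
Definition uniformizer (R : idomainType) (p : R) :=
  p \isn't a GRing.unit /\ forall r, r \is a GRing.unit \/ multiple p r.

Lemma local_pid_uniformizer (R : idomainType) (m : set R) :
  is_pid R -> is_local_with m -> exists2 p, uniformizer p & m = multiple p.
Proof.
move=> pidR [[idm mT _] mmax]; have [p mp] := pidR m idm.
have mE : m = multiple p by [].
exists p => //; split=> [|r].
  apply/negP => /unitrPr[q pq]; apply: mT; apply/seteqP; split=> // x _.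
  by rewrite mE; exists (x * q); rewrite // mulrAC -mulrA pq mulr1.
have [r1|r1] := pselect (multiple r 1); [left|right].
  by case: r1 => s _ sr; apply/unitrPr; exists s; rewrite mulrC.
have [J maxJ rJ] := proper_ideal_maximal (multiple_ideal r) r1.
by rewrite -mE -(mmax J maxJ); apply: rJ; exists 1; rewrite ?mul1r.
Qed.

(** Let [b] generate the ideal of all r with p^n r in (a) for some n. Then p^n b = s a, a = t
    p^(n+1) and t = v b; if a is nonzero, cancelling p^n b gives p s v = 1. *)
Lemma krull_pid (R : idomainType) (p a : R) : is_pid R ->
  p \isn't a GRing.unit -> (forall n, multiple (p ^+ n) a) -> a = 0.
Proof.
move=> pidR pU pa; apply/eqP; apply: contraNT pU => a0.
have [|b Ib] := pidR (fun r => exists n, multiple a (p ^+ n * r)).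
  split=> [|x y [n [s _ sx]] [k [t _ ty]]|r x [n [s _ sx]]].
  - by exists 0; rewrite mulr0; case: (multiple_ideal a).
  - exists (n + k)%N; exists (p ^+ k * s + p ^+ n * t) => //.
    by rewrite mulrDl -!mulrA sx ty exprD; ring.
  - by exists n; exists (r * s); rewrite // -mulrA sx; ring.
have in_I r : (exists n, multiple a (p ^+ n * r)) = multiple b r.
  by rewrite -[LHS]/((fun r => exists n, multiple a (p ^+ n * r)) r) Ib.
have [n [s _ sb]] : exists n, multiple a (p ^+ n * b).
  by rewrite in_I; exists 1; rewrite ?mul1r.
have [t _ ta] := pa n.+1.
have [v _ vt] : multiple b t.
  by rewrite -in_I; exists n.+1; exists 1; rewrite // mul1r -ta mulrC.
have [w _ wa] : multiple b a.
  by rewrite -in_I; exists 0; exists 1; rewrite // expr0.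
have b0 : b != 0 by apply: contraNneq a0 => b0; rewrite -wa b0 mulr0.
have pn0 : p ^+ n != 0.
  by apply: contraNneq a0 => pn0; rewrite -ta exprS pn0 !mulr0.
apply/unitrPr; exists (s * v); apply: (mulfI (mulf_neq0 pn0 b0)).
by rewrite mulr1 -[in RHS]sb -ta -vt exprS; ring.
Qed.

(** Limits are unique by [krull_pid], so incompleteness means that some Cauchy sequence has no
    limit. Reindexing makes its modulus of convergence the identity. *)
Lemma not_complete_sequence (R : idomainType) (p : R) :
    is_pid R -> uniformizer p -> ~ adic_complete (multiple p) ->
  exists2 v : nat -> R,
    forall n k, (n <= k)%N -> multiple (p ^+ n) (v k - v n)
    & forall c, exists n, ~ multiple (p ^+ n) (v n - c).
Proof.
move=> pidR [pU _] Nc; apply: contrapT => Nv; apply: Nc => u cu.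
have [N uN] := boolp.choice cu.
(* The maximum puts [k n] beyond every [N i] with i <= n, so u (k n) and u (k i) agree modulo
   p^i. *)
pose k n := \max_(i < n.+1) N i.
have Nk i n : (i <= n)%N -> (N i <= k n)%N.
  by rewrite -ltnS => lti; apply: (leq_bigmax (Ordinal lti)).
have [c vc] : exists c, forall n, multiple (p ^+ n) (u (k n) - c).
  apply: contrapT => Nc; apply: Nv; exists (u \o k) => [n i le_ni|c].
    by rewrite -ideal_exp_multiple; apply: uN; apply: Nk.
  by apply: contrapT => /forallNP vc; apply: Nc; exists c => n; apply: contrapT.
exists c; split=> [n|d ud].
  exists (k n) => i le_i; rewrite ideal_exp_multiple.
  rewrite -[u i](subrK (u (k n))) -addrA.
  have [_ aD _] := multiple_ideal (p ^+ n); apply: aD (vc n).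
  rewrite -ideal_exp_multiple.
  by apply: uN; rewrite ?Nk // (leq_trans _ le_i) ?Nk.
apply/esym/eqP; rewrite -subr_eq0; apply/eqP/(krull_pid pidR pU) => n.
have [N' uN'] := ud n; pose i := maxn N' (k n).
have := uN' i (leq_maxl _ _); rewrite ideal_exp_multiple => uid.
rewrite (_ : d - c = (u i - u (k n)) - (u i - d) + (u (k n) - c)); last by ring.
have [_ aD _] := multiple_ideal (p ^+ n); apply: aD (vc n).
apply: multipleB uid; rewrite -ideal_exp_multiple.
by apply: uN; rewrite ?Nk // (leq_trans _ (leq_maxr _ _)) ?Nk.
Qed.

(** * Two finiteness tools: Nakayama's lemma and finite generation from finitely many functionals *)

Lemma nakayama (R : idomainType) (p : R) (E : lmodType R) :
    uniformizer p -> finitely_generated E ->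
    (forall x : E, exists y, x = p *: y) ->
  forall x : E, x = 0.
Proof.
move=> [pU pR] [n]; elim: n => [|n IHn] [g gE] Ep.
  by move=> x; have [c ->] := gE x; rewrite big_ord0.
apply: IHn => //; exists (fun i => g (lift ord0 i)) => x.
have [y gy] := Ep (g ord0); have [c yc] := gE y.
have u1 : 1 - p * c ord0 \is a GRing.unit.
  have [//|[b _ bp]] := pR (1 - p * c ord0).
  case/negP: pU; apply/unitrPr; exists (b + c ord0).
  by rewrite mulrDr [p * b]mulrC bp subrK.
have g0 : (1 - p * c ord0) *: g ord0 =
          \sum_(i < n) (p * c (lift ord0 i)) *: g (lift ord0 i).
  rewrite scalerBl scale1r [X in X - _]gy yc big_ord_recl scalerDr scalerA.
  by rewrite addrAC subrr add0r scaler_sumr; under eq_bigr do rewrite scalerA.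
have [d ->] := gE x; rewrite big_ord_recl.
rewrite -[g ord0]scale1r -(mulVr u1) -scalerA g0 !scaler_sumr.
exists (fun i =>
  d ord0 * ((1 - p * c ord0)^-1 * (p * c (lift ord0 i))) + d (lift ord0 i)).
rewrite -big_split; apply: eq_bigr => i _.
by rewrite /= !scalerA scalerDl !mulrA.
Qed.

(** Induction on [n]: the remaining functionals handle the kernel of [h ord0], whose image is a
    principal ideal (a); a preimage [x0] of a completes the generators of the kernel. *)
Lemma jointly_injective_fg (R : idomainType) n (M : lmodType R)
    (h : 'I_n -> {linear M -> R^o}) :
    is_pid R -> (forall x, (forall i, h i x = 0) -> x = 0) ->
  finitely_generated M.
Proof.
move=> pidR; elim: n M h => [|n IHn] M h hinj.
  exists 0, (fun=> 0) => x; exists (fun=> 0).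
  by rewrite big_ord0; apply: hinj => -[].
have [n' [g gE]] : finitely_generated (ker (h ord0)).
  pose inc : {linear ker (h ord0) -> M} := (val : ker (h ord0) -> M).
  apply: (IHn _ (fun i => h (lift ord0 i) \o inc)) => z hz.
  apply/val_inj/hinj => i; case: (unliftP ord0 i) => [j ->|->]; first exact: hz.
  exact/eqP/(valP z).
have [|a ha] := pidR (range (h ord0)).
  split=> [|_ _ [x _ <-] [y _ <-]|b _ [x _ <-]].
  - by exists 0; rewrite ?linear0.
  - by exists (x + y); rewrite ?linearD.
  - by exists (b *: x); rewrite ?linearZ.
have [x0 _ hx0] : range (h ord0) a by rewrite ha; exists 1; rewrite ?mul1r.
(* The default of [oapp] is reached exactly at [ord0], which carries [x0]; the other indices carry
   the generators of the kernel. *)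
exists n'.+1, (fun i => oapp (fun j => val (g j)) x0 (unlift ord0 i)) => x.
have [b _ hx] : multiple a (h ord0 x) by rewrite /multiple -ha; exists x.
have xk : x - b *: x0 \in ker_pred (h ord0).
  by rewrite unfold_in /ker_pred linearB linearZ /= hx0 -hx subrr.
have [c cE] := gE (exist (fun u => u \in ker_pred (h ord0)) _ xk).
exists (fun i => oapp c b (unlift ord0 i)).
rewrite big_ord_recl unlift_none /=; under eq_bigr do rewrite liftK /=.
rewrite -[x in LHS](subrK (b *: x0)) addrC; congr (_ + _).
pose inc : {linear ker (h ord0) -> M} := (val : ker (h ord0) -> M).
have -> : x - b *: x0 = inc (\sum_(i < n') c i *: g i) by rewrite -cE.
by rewrite linear_sum; apply: eq_bigr => i _; rewrite linearZ.
Qed.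

(** * Homology classes, and passage between functionals and elements of [hom] *)

Section HomologyClass.
Variables (R : pzRingType) (U V W : lmodType R).
Variables (f : {linear U -> V}) (g : {linear V -> W}).

Definition homology_class : {linear ker g -> homology f g} :=
  modquot_pi (boundary_pred f (g := g)).

Lemma homology_class_surj (q : homology f g) : exists z, homology_class z = q.
Proof. exact: modquot_pi_surj. Qed.

Lemma homology_class_eq0 z : homology_class z = 0 <-> exists u, f u = val z.
Proof.
by split=> [/modquot_pi_eq0/asboolP|?] //; apply/modquot_pi_eq0/asboolP.
Qed.

Lemma homology_class_lincomb n (c : 'I_n -> R) (z : ker g) (y : 'I_n -> ker g) :
    homology_class z = \sum_(i < n) c i *: homology_class (y i) ->
  exists u, f u = val z - \sum_(i < n) c i *: val (y i).
Proof.
move=> zE; have /homology_class_eq0[u fu] :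
    homology_class (z - \sum_(i < n) c i *: y i) = 0.
  rewrite linearB zE linear_sum -sumrB big1 // => i _.
  by rewrite linearZ subrr.
exists u; pose inc : {linear ker g -> V} := (val : ker g -> V).
by rewrite fu -[LHS]/(inc _) linearB linear_sum.
Qed.

Lemma homology_class_scale a (z y : ker g) u :
  f u = val z - a *: val y -> homology_class z = a *: homology_class y.
Proof.
move=> fu; apply/eqP; rewrite -linearZ -subr_eq0 -linearB.
by apply/eqP/homology_class_eq0; exists u.
Qed.

End HomologyClass.

Arguments homology_class {R U V W} f g.

(** Left exactness of Hom(V, -) on 0 -> R -> K -> K/R; it turns K-valued maps into functionals. *)
Lemma integral_factor (R : idomainType) (V : lmodType R)
    (f : {linear V -> fracmod R}) : (forall x, to_fracquot (f x) = 0) ->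
  exists g : {linear V -> R^o}, forall x, to_fracmod (g x) = f x.
Proof.
move=> f0.
have /boolp.choice[g gE] x : exists a, f x = to_fracmod a.
  exact/to_fracquot_eq0.
have glin : linear g.
  by move=> a x y; apply: to_fracmod_inj; rewrite linearP /= -!gE linearP.
pose gL := GRing.isLinear.Build R V R^o _ g glin.
by exists (HB.pack_for {linear V -> R^o} g gL) => x; rewrite gE.
Qed.

Section LinearHom.
Variables (R : comNzRingType) (U V : lmodType R).

Lemma linear_hom_subproof (f : {linear U -> V}) :
  (f : U -> V) \in @hom_pred R U V.
Proof. by apply/asboolP; apply: linearP. Qed.

Definition linear_hom (f : {linear U -> V}) : hom U V :=
  exist _ (f : U -> V) (linear_hom_subproof f).

Lemma hom_linear (z : hom U V) : exists f : {linear U -> V}, z = linear_hom f.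
Proof.
have /asboolP zlin := valP z.
pose fL := GRing.isLinear.Build R U V _ (val z) zlin.
by exists (HB.pack_for {linear U -> V} (val z) fL); apply/val_inj.
Qed.

End LinearHom.

(** * Ext^0 and Ext^1 with values in R, from any projective resolution *)

Section CohomologicallyFinite.
Variables (R : idomainType) (M : lmodType R) (P : proj_resolution M).
Hypothesis pidR : is_pid R.

Local Notation d := (res_diff P).
Local Notation aug := (res_aug P).

(** Divides the class of [phi] in Ext^1 by p. A K-valued extension [L] of [phi] along [d 0] is
    reduced mod R and divided by p on M; a lift [N] of the result to K yields psi = N d_0 and t = L
    - p N. *)
Lemma cocycle_divisible (p : R) (phi : {linear res_mod P 1 -> R^o}) :
    torsion_free M -> p != 0 -> (forall y, phi (d 1 y) = 0) ->
  exists (psi : {linear res_mod P 1 -> R^o}) (t : {linear res_mod P 0 -> R^o}),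
    (forall y, psi (d 1 y) = 0) /\
    (forall y, phi y - p *: psi y = t (d 0 y)).
Proof.
move=> Mtf p0 phi1.
have [|L LE] := divisible_extend (i := d 0) (f := @to_fracmod R \o phi)
    pidR (@fracmod_divisible R).
  by move=> y /res_exactS[z <-] /=; rewrite phi1 linear0.
(* Extending along p aug instead of aug performs the division: p f(aug x) = L x mod R. Both maps
   have the same kernel, as M is torsion-free. *)
have [x|f fE] := divisible_extend (i := p \*: aug)
    (f := to_fracquot \o L) pidR (@fracquot_divisible R).
  move=> /= /Mtf[/eqP|/res_exact0[y <-]]; first by rewrite (negPf p0).
  by rewrite LE; apply/to_fracquot_eq0; exists (phi y).
have [x|N NE] := @res_projective _ _ P 0 _ _ (to_fracquot) (f \o aug).
  exact: to_fracquot_surj.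
have [y|psi psiE] := integral_factor (f := N \o d 0).
  rewrite /= NE /=; have -> : aug (d 0 y) = 0 by apply/res_exact0; exists y.
  by rewrite linear0.
have [x|t tE] := integral_factor (f := L \- p \*: N).
  rewrite /= linearB linearZ /= NE /= -linearZ /=.
  by have /= -> := fE x; rewrite subrr.
exists psi, t; split=> y; apply: to_fracmod_inj.
  rewrite psiE /= (_ : d 0 (d 1 y) = 0) ?linear0 //.
  by apply/res_exactS; exists y.
by rewrite tE linearB linearZ /= psiE LE.
Qed.

Lemma cocycle_subproof n (phi : {linear res_mod P n -> R^o}) :
    (forall y, phi (d n y) = 0) ->
  linear_hom phi \in ker_pred (precomp R^o (d n)).
Proof. by move=> phi1; apply/eqP/val_inj/funext => y; apply: phi1. Qed.

Definition cocycle n (phi : {linear res_mod P n -> R^o})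
    (phi1 : forall y, phi (d n y) = 0) : ker (precomp R^o (d n)) :=
  exist (fun z => z \in ker_pred (precomp R^o (d n))) _ (cocycle_subproof phi1).

Lemma cocycle_surj n (z : ker (precomp R^o (d n))) :
  exists (phi : {linear res_mod P n -> R^o}) (phi1 : forall y, phi (d n y) = 0),
    z = cocycle phi1.
Proof.
have [phi zE] := hom_linear (val z).
have phi1 y : phi (d n y) = 0.
  by have /eqP/(congr1 val)/(congr1 (@^~ y)) := valP z; rewrite zE.
by exists phi, phi1; apply: val_inj.
Qed.

Lemma ext1_eq0 (p : R) : uniformizer p -> p != 0 -> torsion_free M ->
    finitely_generated (resolution_ext R^o P 1) ->
  forall q : resolution_ext R^o P 1, q = 0.
Proof.
move=> up p0 Mtf fgE; apply: (nakayama up fgE) => q.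
have [z <-] := homology_class_surj q; have [phi [phi1 ->]] := cocycle_surj z.
have [psi [t [psi1 psiE]]] := cocycle_divisible Mtf p0 phi1.
exists (homology_class _ _ (cocycle psi1)).
apply: (homology_class_scale (u := linear_hom t)).
by apply/val_inj/funext => y; apply/esym/psiE.
Qed.

Lemma cocycle_coboundary (p : R) (phi : {linear res_mod P 1 -> R^o}) :
    uniformizer p -> p != 0 -> torsion_free M ->
    finitely_generated (resolution_ext R^o P 1) ->
    (forall y, phi (d 1 y) = 0) ->
  exists t : {linear res_mod P 0 -> R^o}, forall y, phi y = t (d 0 y).
Proof.
move=> up p0 Mtf fgE phi1.
have /homology_class_eq0[z zE] :=
  ext1_eq0 up p0 Mtf fgE (homology_class _ _ (cocycle phi1)).
have [t zt] := hom_linear z; exists t => y.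
by have /(congr1 val)/(congr1 (@^~ y)) := zE; rewrite zt.
Qed.

(** The connecting map Hom(M, K/R) -> Ext^1(M, R) vanishes. Explicitly, a lift [L] of f aug to K
    gives an integral cocycle L d_0, equal to t d_0 for some [t]; then L - t descends to M and lifts
    [f]. *)
Lemma lift_fracquot (p : R) (f : {linear M -> fracquot R}) :
    uniformizer p -> p != 0 -> torsion_free M ->
    finitely_generated (resolution_ext R^o P 1) ->
  exists h : {linear M -> fracmod R}, forall x, to_fracquot (h x) = f x.
Proof.
move=> up p0 Mtf fgE.
have [x|L LE] := @res_projective _ _ P 0 _ _ (to_fracquot) (f \o aug).
  exact: to_fracquot_surj.
have [y|phi phiE] := integral_factor (f := L \o d 0).
  rewrite /= LE /=; have -> : aug (d 0 y) = 0 by apply/res_exact0; exists y.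
  by rewrite linear0.
have [y|t tE] := cocycle_coboundary (phi := phi) up p0 Mtf fgE.
  apply: to_fracmod_inj; rewrite phiE /= (_ : d 0 (d 1 y) = 0) ?linear0 //.
  by apply/res_exactS; exists y.
have [||h hE] := linear_factor (g := aug) (f := L \- (@to_fracmod R \o t)).
- exact: res_aug_surj.
- by move=> x /res_exact0[y <-] /=; rewrite -tE phiE subrr.
exists h => x; have [y <-] := res_aug_surj P x.
rewrite hE linearB LE /= [X in _ - X](_ : _ = 0) ?subr0 //.
by apply/to_fracquot_eq0; exists (t y).
Qed.

(** Ext^0(M, R) is Hom(M, R): a 0-cocycle vanishes on the image of [d 0], the kernel of [aug], and
    so factors through M. *)
Lemma dual_generators :
    finitely_generated (resolution_ext R^o P 0) ->
  exists n (g : 'I_n -> {linear M -> R^o}), forall h : {linear M -> R^o},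
    exists c : 'I_n -> R, forall x, h x = \sum_(i < n) c i *: g i x.
Proof.
move=> [n [e eE]].
have augk (g : {linear M -> R^o}) y : (g \o aug) (d 0 y) = 0.
  by rewrite -[RHS](linear0 g) /=; congr (g _); apply/res_exact0; exists y.
have /boolp.choice[g gE] i : exists g : {linear M -> R^o},
    e i = homology_class _ _ (cocycle (augk g)).
  have [z <-] := homology_class_surj (e i); have [f [f0 ->]] := cocycle_surj z.
  have [||g gE] := linear_factor (g := aug) (f := f).
  - exact: res_aug_surj.
  - by move=> x /res_exact0[y <-].
  exists g; congr (homology_class _ _ _).
  by apply/val_inj/val_inj/funext => x; rewrite /= gE.
exists n, g => h; have [c hE] := eE (homology_class _ _ (cocycle (augk h))).
have [|u /esym/eqP] := homology_class_lincomb (c := c)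
    (y := fun i => cocycle (augk (g i))) (etrans hE _).
  by apply: eq_bigr => i _; rewrite gE.
(* The incoming map in degree 0 is zero, so equality of classes is equality of cocycles. *)
rewrite subr_eq0 => /eqP hgE.
exists c => x; have [y <-] := res_aug_surj P x.
pose ev (z : hom (res_mod P 0) R^o) : R^o := val z y.
have -> : h (aug y) = ev (linear_hom (h \o aug)) by [].
by rewrite [linear_hom _]hgE (big_morph ev (id1 := 0) (op1 := +%R)).
Qed.

End CohomologicallyFinite.

(** Serves to compare v_k / p^k with p^j v_(k+j) / p^(k+j): here a = v_k, x = p^k, y = p^j and
    v_(k+j) = a + b x. *)
Lemma sub_fractions (F : fieldType) (a b x y : F) : x != 0 -> y != 0 ->
  a / x - y * ((a + b * x) / (x * y)) = - b.
Proof. by move=> x0 y0; field; rewrite x0 y0. Qed.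

(** * Elements of M killed by every functional M -> R *)

Section Annihilated.
Variables (R : idomainType) (M : lmodType R) (p : R).
Hypotheses (pidR : is_pid R) (up : uniformizer p) (p0 : p != 0).
Hypothesis lifts : forall f : {linear M -> fracquot R},
  exists h : {linear M -> fracmod R}, forall x, to_fracquot (h x) = f x.

Local Notation annihilated x := (forall h : {linear M -> R^o}, h x = 0).

Let fp0 : tofrac p != 0.
Proof. by rewrite tofrac_eq0. Qed.

Lemma annihilated_divisible (x : M) : annihilated x -> exists z, p *: z = x.
Proof.
move=> hx0; apply: contrapT => px.
pose w : fracmod R := (tofrac p)^-1.
(* The graph of r x + p z |-> r/p mod R on R x + p M. *)
pose G : set (M * fracquot R) :=
  fun y => exists r z, y = (r *: x + p *: z, to_fracquot (r *: w)).
have [||||f fE] := @divisible_extend_relation R M (fracquot R) G pidR.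
- exact: fracquot_divisible.
- by exists 0, 0; rewrite !scale0r !scaler0 addr0 linear0.
- move=> a _ _ [r [z ->]] [s [t ->]]; exists (a * r + s), (a *: z + t).
  congr pair; last by rewrite /= [in RHS]scalerDl -scalerA linearP.
  by rewrite /= scalerDl !scalerDr addrACA !scalerA [p * a]mulrC.
- move=> d [r [z [/esym/eqP rz ->]]]; apply/to_fracquot_eq0.
  (* If r were a unit, r x + p z = 0 would put x in p M; hence p divides r and r/p is integral. *)
  have [rU|[b _ <-]] := up.2 r.
    case: px; exists (- r^-1 *: z); rewrite scalerA mulrC -scalerA.
    move: rz; rewrite addr_eq0 => /eqP rx.
    by rewrite scaleNr -scalerN -rx scalerA mulVr // scale1r.
  exists b; rewrite -scalerA -[RHS]mulr1; congr (_ * _).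
  by rewrite fracmod_scaleE mulfV.
have [h hE] := lifts f.
(* As [f] vanishes on p M, p h is a functional into R and kills [x]. So h x = 0, although f x is 1/p
   mod R, which is nonzero because p is not a unit. *)
have [y|g gE] := integral_factor (f := p \*: h).
  rewrite /= linearZ /= hE -linearZ /=; apply: fE.
  by exists 0, y; rewrite !scale0r add0r linear0.
have : p *: h x = 0 by rewrite -[LHS](gE x) hx0 linear0.
move=> /eqP; rewrite fracmod_scaleE mulf_eq0 (negPf fp0) => /eqP hx.
have := hE x; rewrite hx linear0 (fE x (to_fracquot w)); last first.
  by exists 1, 0; rewrite !scale1r scaler0 addr0.
move=> /esym/to_fracquot_eq0[a wa]; case/negP: up.1; apply/unitrPr; exists a.
apply: to_fracmod_inj; rewrite -[p * a]/(p *: (a : R^o)) linearZ /= -wa.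
by rewrite fracmod_scaleE mulfV // [RHS]tofrac1.
Qed.

Lemma annihilated_eq0 (v : nat -> R) (x : M) :
    torsion_free M ->
    (forall n k, (n <= k)%N -> multiple (p ^+ n) (v k - v n)) ->
    (forall c, exists n, ~ multiple (p ^+ n) (v n - c)) ->
  annihilated x -> x = 0.
Proof.
move=> Mtf vcau vdiv hx0; apply: contrapT => x0.
(* Division by p made total, with an irrelevant value off the annihilated elements, so that it can
   be iterated from [x]. *)
have /boolp.choice[q qE] y : exists z, annihilated y -> p *: z = y.
  have [/annihilated_divisible[z <-]|] := pselect (annihilated y).
    by exists z.
  by exists 0.
pose s k := iter k q x.
have hs k : annihilated (s k).
  elim: k => // k IHk h; have /eqP := IHk h.
  by rewrite -(qE _ IHk) linearZ mulf_eq0 (negPf p0) => /eqP.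
have sS k : p *: s k.+1 = s k by exact: qE.
have sE k j : s k = p ^+ j *: s (k + j)%N.
  elim: j => [|j IHj]; first by rewrite addn0 scale1r.
  by rewrite addnS exprSr -scalerA sS.
have fpk k : tofrac (p ^+ k) != 0 by rewrite tofrac_eq0 expf_neq0.
pose w k : fracmod R := tofrac (v k) / tofrac (p ^+ k).
pose e k := to_fracquot (w k).
have eE k j : e k = p ^+ j *: e (k + j)%N.
  apply/eqP; rewrite -linearZ -subr_eq0 -linearB; apply/eqP/to_fracquot_eq0.
  have [b _ bE] := vcau k (k + j)%N (leq_addr _ _).
  exists (- b); rewrite /to_fracmod rmorphN /= fracmod_scaleE /w.
  have -> : v (k + j)%N = v k + b * p ^+ k by rewrite bE addrC subrK.
  by rewrite exprD rmorphD !rmorphM; apply: sub_fractions.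
(* The union of the graphs R (s_k, e_k), increasing in k by [sE] and [eE]. It is single-valued since
   M is torsion-free and s_k = 0 would force x = 0. *)
pose G : set (M * fracquot R) := fun y => exists r k, y = (r *: s k, r *: e k).
have [||||f fE] := @divisible_extend_relation R M (fracquot R) G pidR.
- exact: fracquot_divisible.
- by exists 0, 0; rewrite !scale0r.
- move=> a _ _ [r [k ->]] [r' [k' ->]].
  exists (a * r * p ^+ k' + r' * p ^+ k), (k + k')%N.
  rewrite (sE k k') (eE k k') (sE k' k) (eE k' k) [(k' + k)%N]addnC.
  by congr pair; rewrite /= !scalerDl !scalerA ?mulrA.
- move=> d [r [k [/esym/Mtf[->|sk0] ->]]]; first by rewrite scale0r.
  by case: x0; rewrite -[x]/(s 0) (sE 0 k) add0n sk0 scaler0.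
have [h hE] := lifts f.
have hsk k : to_fracquot (h (s k)) = e k.
  by rewrite hE; apply: fE; exists 1, k; rewrite !scale1r.
have [c cE] : exists c, h x = to_fracmod c.
  apply/to_fracquot_eq0; rewrite (hsk 0) /e; apply/to_fracquot_eq0.
  by exists (v 0); rewrite /w expr0 rmorph1 divr1.
have [n] := vdiv c; apply.
have /eqP := hsk n; rewrite -subr_eq0 -linearB => /eqP/to_fracquot_eq0[b bE].
(* Multiply h(s_n) = v_n / p^n + b by p^n. Thus [c], the value of h at x, is congruent to v_n modulo
   p^n at the very level [n] where [vdiv] denies it. *)
have -> : c = v n + p ^+ n * b.
  apply: to_fracmod_inj; rewrite -cE -[x]/(s 0) (sE 0 n) add0n linearZ /=.
  rewrite -[h _](subrK (w n)) bE fracmod_scaleE mulrDr addrC.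
  by rewrite [RHS]rmorphD rmorphM; congr (_ + _); rewrite mulrC divfK.
by exists (- b) => //; rewrite opprD addNKr mulNr mulrC.
Qed.

End Annihilated.

Theorem proposition5p2 (R : idomainType) (m : set R) (M : lmodType R)
    (R_pid : is_pid R) (R_local : is_local_with m)
    (R_not_complete : ~ adic_complete m)
    (M_torsion_free : torsion_free M)
    (M_cohom_finite : cohomologically_finite M) :
  finitely_generated M.
Proof.
have [p up mE] := local_pid_uniformizer R_pid R_local.
rewrite mE in R_not_complete.
have [v vcau vdiv] := not_complete_sequence R_pid up R_not_complete.
have p0 : p != 0.
  (* If p = 0, the sequence is constant from index 1 on, so v_1 would be its limit; the congruence
     at level 0 is trivial. *)
  apply/eqP => p0; have [n] := vdiv (v 1); apply.
  case: n => [|n]; first by exists (v 0 - v 1); rewrite // expr0 mulr1.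
  by have := vcau 1 n.+1 isT; rewrite p0 !expr0n.
have [n [g gE]] := dual_generators (M_cohom_finite 0).
apply: (jointly_injective_fg (h := g) R_pid) => x gx0.
have {gx0} hx0 (h : {linear M -> R^o}) : h x = 0.
  by have [c ->] := gE h; rewrite big1 // => i _; rewrite gx0 scaler0.
apply: (annihilated_eq0 R_pid up p0 _ M_torsion_free vcau vdiv hx0) => f.
exact: (lift_fracquot R_pid f up p0 M_torsion_free (M_cohom_finite 1)).
Qed.
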